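(* Let $n\ge 1$. For every permutation $\pi\in S_n$, two or fewer applications of the map $f:S_n\to S_n$ to $\pi$ result in a fixed point of $f$; that is, there is $k\in\{0,1,2\}$ such that $f(f^k(\pi))=f^k(\pi)$, where $f^k$ denotes the $k$-fold iterate of $f$.
   Context: $S_n$ is the set of permutations of $1,2,\ldots,n$, written as words $\pi=\pi_1,\ldots,\pi_n$. A Young diagram of a partition $\lambda=(\lambda_1\ge\cdots\ge\lambda_k>0)$ of $n$ is drawn in French notation: left-justified rows, with $\lambda_i$ boxes in the $i$-th row from the bottom. A standard Young tableau (SYT) of shape $\lambda$ is a filling of the boxes with $1,\ldots,n$, each used once, with rows increasing left to right and columns increasing bottom to top. RSK: for $\pi\in S_n$, $\mathrm{RSK}(\pi)=(S,T)$, where $S$ (the insertion tableau) is obtained by starting from the empty tableau and inserting $\pi_1,\pi_2,\ldots,\pi_n$ in order. To insert $a$ into a row (starting with the bottom row): if $a$ is larger than every entry of the row, place $a$ at the end of the row and stop; otherwise $a$ replaces the leftmost entry $b$ of the row that is greater than $a$, and $b$ is then inserted into the next row up by the same rule. The recording tableau $T$ has the same shape as $S$, with the box that is newly created when inserting $\pi_i$ labeled $i$. RSK is a bijection from $S_n$ to pairs of SYT of size $n$ of the same shape. The reading word of an SYT is the permutation obtained by concatenating its rows from the top row to the bottom row, each read left to right. The map $f:S_n\to S_n$ is defined by: if $\mathrm{RSK}(\pi)=(S,T)$, then $f(\pi)$ is the reading word of $T$. A fixed point of $f$ is a permutation $\pi$ with $f(\pi)=\pi$. *)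

(* Defs.v *)
From mathcomp Require Import all_boot all_fingroup.

Set Implicit Arguments.
Unset Strict Implicit.
Unset Printing Implicit Defensive.

(* Rows are listed from bottom to top (French notation), each row from left
   to right. *)
Definition tableau := seq (seq nat).

(* The second component is the index (0 for the bottom row) of the row of [t]
   that receives a new box; this box is the last one of its row. *)
Fixpoint insert (a : nat) (t : tableau) : tableau * nat :=
  if t is r :: t' then
    let i := find (fun b => a < b) r in
    if i < size r then
      let: (u, j) := insert (nth 0 r i) t' in (set_nth 0 r i a :: u, j.+1)
    else (rcons r a :: t', 0)
  else ([:: [:: a]], 0).

Definition add_box (x j : nat) (t : tableau) : tableau :=
  set_nth [::] t j (rcons (nth [::] t j) x).

Definition RSK_step (ST : tableau * tableau) (ai : nat * nat) :
    tableau * tableau :=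
  let: (P, j) := insert ai.1 ST.1 in (P, add_box ai.2 j ST.2).

Definition RSK_word (w : seq nat) : tableau * tableau :=
  foldl RSK_step ([::], [::]) (zip w (iota 1 (size w))).

Definition reading_word (t : tableau) : seq nat := flatten (rev t).

(* ['S_n] permutes {0, ..., n-1}; words use the letters 1, ..., n. *)
Definition word n (pi : 'S_n) : seq nat := [seq (pi i).+1 | i <- enum 'I_n].

Definition RSK n (pi : 'S_n) : tableau * tableau := RSK_word (word pi).

Lemma size_word n (pi : 'S_n) : size (word pi) = n.
Proof. by rewrite size_map size_enum_ord. Qed.

Lemma perm_reading_add_box x j t :
  perm_eq (reading_word (add_box x j t)) (x :: reading_word t).
Proof.
have perm_revf (s : tableau) : perm_eq (reading_word s) (flatten s).
  by apply: perm_flatten; rewrite perm_rev.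
apply: (perm_trans (perm_revf _)); rewrite perm_sym.
apply: (@perm_trans _ (x :: flatten t)); first by rewrite perm_cons.
rewrite perm_sym /add_box; elim: t j => [|r t IHt] [|j] //=.
- by elim: j.
- by rewrite cat_rcons perm_catC /= perm_cons perm_catC.
- apply: (@perm_trans _ (r ++ x :: flatten t)); first by rewrite perm_cat2l.
  by rewrite -cat1s perm_catCA.
Qed.

Lemma perm_reading_RSK w :
  perm_eq (reading_word (RSK_word w).2) (iota 1 (size w)).
Proof.
rewrite /RSK_word.
suff H (s : seq (nat * nat)) ST :
    perm_eq (reading_word (foldl RSK_step ST s).2)
            (unzip2 s ++ reading_word ST.2).
  by have := H (zip w (iota 1 (size w))) ([::], [::]);
    rewrite cats0 unzip2_zip ?size_iota.
elim: s ST => [|ai s IHs] ST //=; apply: (perm_trans (IHs _)).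
rewrite /RSK_step; case: insert => P j /=.
apply: (@perm_trans _ (unzip2 s ++ ai.2 :: reading_word ST.2)).
  by rewrite perm_cat2l perm_reading_add_box.
by rewrite -cat1s perm_catCA.
Qed.

(* When [w] is a word in the letters 1, ..., n, the default value [i] of
   [insubd] is not used. *)
Definition fun_of_word n (w : seq nat) (i : 'I_n) : 'I_n :=
  insubd i (nth 0 w i).-1.

Lemma fun_of_wordE n (w : seq nat) (i : 'I_n) :
  perm_eq w (iota 1 n) -> (fun_of_word w i).+1 = nth 0 w i.
Proof.
move=> Hw; have: nth 0 w i \in iota 1 n.
  by rewrite -(perm_mem Hw) mem_nth // (perm_size Hw) size_iota.
rewrite mem_iota add1n ltnS => /andP[w_gt0 w_le].
have w_lt : (nth 0 w i).-1 < n by rewrite prednK.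
by rewrite /fun_of_word insubdK ?prednK.
Qed.

Lemma fun_of_word_inj n (w : seq nat) :
  perm_eq w (iota 1 n) -> injective (@fun_of_word n w).
Proof.
move=> Hw i j eq_ij; apply/val_inj/eqP.
have szw : size w = n by rewrite (perm_size Hw) size_iota.
have uw : uniq w by rewrite (perm_uniq Hw) iota_uniq.
by rewrite -(nth_uniq 0 _ _ uw) ?szw ?ltn_ord // -(fun_of_wordE i Hw) eq_ij fun_of_wordE.
Qed.

Lemma perm_reading_recording n (pi : 'S_n) :
  perm_eq (reading_word (RSK pi).2) (iota 1 n).
Proof. by rewrite -[in iota 1 n](size_word pi) perm_reading_RSK. Qed.

(* [f pi] is the permutation whose word is the reading word of the recording
   tableau of [pi]; see [word_f]. *)
Definition f n (pi : 'S_n) : 'S_n :=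
  perm (fun_of_word_inj (perm_reading_recording pi)).

Lemma word_f n (pi : 'S_n) : word (f pi) = reading_word (RSK pi).2.
Proof.
have Hw := perm_reading_recording pi.
have szw : size (reading_word (RSK pi).2) = n.
  by rewrite (perm_size Hw) size_iota.
apply: (@eq_from_nth _ 0) => [|i]; rewrite size_word ?szw // => lt_in.
rewrite (nth_map (Ordinal lt_in)) ?size_enum_ord // permE fun_of_wordE //.
by rewrite nth_enum_ord.
Qed.

Lemma word_inj n : injective (@word n).
Proof.
move=> p q /eq_in_map eq_pq; apply/permP => i; apply/val_inj.
by have [] := eq_pq i (mem_enum _ _).
Qed.

(* Main.v *)
Require Import Defs.
From mathcomp Require Import all_boot all_fingroup.

Set Implicit Arguments.
Unset Strict Implicit.
Unset Printing Implicit Defensive.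

(** Row-inserting the reading word of a tableau [t] rebuilds [t] row by row:
the letter in column [l] of the next row bumps the whole column [l] up by one,
so the box it creates sits on top of that column.  Hence the recording tableau
of the reading word depends only on the shape of [t], and has this same shape.
With [T] the recording tableau of [pi], the recording tableaux of [f pi] and of
[f (f pi)] therefore coincide, and [f (f pi)] is fixed.  Tableaux are taken
semistandard, which spares any distinctness hypothesis on the words. *)

(** * Semistandard tableaux and row insertion *)

Definition below (r r' : seq nat) :=
  (size r' <= size r) && all (fun l => nth 0 r l < nth 0 r' l) (iota 0 (size r')).

Fixpoint semistandard (t : tableau) : bool :=
  if t is r :: t' then
    [&& r != [::], sorted leq r, below r (head [::] t') & semistandard t']
  else true.

Lemma belowP r r' :
  reflect (size r' <= size r /\ forall l, l < size r' -> nth 0 r l < nth 0 r' l)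
          (below r r').
Proof.
apply: (iffP andP) => -[le_r lt_r]; split=> //.
  by move=> l lt_l; apply: (allP lt_r); rewrite mem_iota.
by apply/allP => l; rewrite mem_iota => /lt_r.
Qed.

Lemma nth_leq_sorted r i j :
  sorted leq r -> i <= j -> j < size r -> nth 0 r i <= nth 0 r j.
Proof.
move=> r_sorted le_ij lt_j.
by apply: (sorted_leq_nth leq_trans leqnn 0 r_sorted); rewrite ?inE // (leq_ltn_trans le_ij).
Qed.

Definition bump_pos a (r : seq nat) := find (fun b => a < b) r.

(* At position [size r], [set_nth] appends, so this also covers the case where
   nothing is bumped. *)
Definition row_insert a (r : seq nat) := set_nth 0 r (bump_pos a r) a.

Lemma bump_pos_size a r : bump_pos a r <= size r.
Proof. exact: find_size. Qed.

Lemma nth_before_bump a r l : l < bump_pos a r -> nth 0 r l <= a.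
Proof. by move=> /(before_find 0); rewrite ltnNge => /negbFE. Qed.

Lemma nth_bump a r : bump_pos a r < size r -> a < nth 0 r (bump_pos a r).
Proof. by rewrite -has_find => /(nth_find 0). Qed.

Lemma size_row_insert a r : size (row_insert a r) = maxn (bump_pos a r).+1 (size r).
Proof. exact: size_set_nth. Qed.

Lemma row_insert_rcons a r :
  size r <= bump_pos a r -> row_insert a r = rcons r a.
Proof.
move=> ge_r; rewrite /row_insert; have -> : bump_pos a r = size r.
  by apply/eqP; rewrite eqn_leq bump_pos_size.
by elim: r {ge_r} => //= b r ->.
Qed.

Lemma sorted_row_insert a r : sorted leq r -> sorted leq (row_insert a r).
Proof.
move=> r_sorted; apply/(sortedP 0) => i; rewrite size_row_insert => lt_i.
rewrite !nth_set_nth /=.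
case: (eqVneq i (bump_pos a r)) => [eq_i | ne_i].
  rewrite gtn_eqF ?eq_i //; rewrite eq_i in lt_i.
  have lt_r : (bump_pos a r).+1 < size r by move: lt_i; rewrite leq_max ltnn.
  rewrite (leq_trans (ltnW (nth_bump (ltnW lt_r)))) //.
  by rewrite nth_leq_sorted.
case: eqP => [eq_i | /eqP ne_i1].
  by rewrite nth_before_bump // -eq_i.
rewrite nth_leq_sorted //; move: lt_i; rewrite leq_max => /orP[lt_i|//].
apply: leq_trans (bump_pos_size a r).
by rewrite ltn_neqAle ne_i1.
Qed.

(** The bumped letter [b] moves weakly left, because an entry of [r'] above it already exceeds [b].
    Where [b] lands, the entry beneath is at most [a], hence below [b]; in the other columns the
    lower entry can only have decreased. *)
Lemma below_row_insert a r r' (b := nth 0 r (bump_pos a r)) :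
  below r r' -> bump_pos a r < size r ->
  below (row_insert a r) (row_insert b r').
Proof.
move=> /belowP[le_r lt_r] lt_pos.
have le_pos : bump_pos b r' <= bump_pos a r.
  rewrite leqNgt; apply/negP => lt_pos'.
  have := nth_before_bump lt_pos'; rewrite leqNgt lt_r //.
  exact: leq_trans lt_pos' (bump_pos_size _ _).
have row_le l : nth 0 (row_insert a r) l <= nth 0 r l.
  by rewrite nth_set_nth /=; case: eqP => // ->; apply/ltnW/nth_bump.
apply/belowP; split.
  by rewrite !size_row_insert geq_max !leq_max ltnS le_pos le_r orbT.
move=> l lt_l; rewrite [X in _ < X]nth_set_nth /=; case: eqP => [->|/eqP ne_l].
  apply: leq_ltn_trans (nth_bump lt_pos).
  rewrite nth_set_nth /=; case: eqP => // /eqP ne_pos.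
  by rewrite nth_before_bump // ltn_neqAle ne_pos.
apply: leq_ltn_trans (row_le l) (lt_r l _).
move: lt_l; rewrite size_row_insert leq_max => /orP[lt_l|//].
apply: leq_trans (bump_pos_size b r').
by rewrite ltn_neqAle ne_l.
Qed.

Lemma below_rcons a r r' : below r r' -> below (rcons r a) r'.
Proof.
move=> /belowP[le_r lt_r]; apply/belowP; split; first by rewrite size_rcons leqW.
by move=> l lt_l; rewrite nth_rcons (leq_trans lt_l le_r) lt_r.
Qed.

Lemma row_insert_neq0 a r : row_insert a r != [::].
Proof. by rewrite -size_eq0 size_row_insert -lt0n leq_max. Qed.

Lemma insert_cons a r t :
  insert a (r :: t) =
  if bump_pos a r < size r then
    let u := insert (nth 0 r (bump_pos a r)) t in (row_insert a r :: u.1, u.2.+1)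
  else (rcons r a :: t, 0).
Proof. by rewrite /= -/(bump_pos a r); case: ltnP => //; case: insert. Qed.

Lemma head_insert a t : head [::] (insert a t).1 = row_insert a (head [::] t).
Proof.
by case: t => // r t; rewrite insert_cons; case: ltnP => //= /row_insert_rcons.
Qed.

Lemma semistandard_insert a t : semistandard t -> semistandard (insert a t).1.
Proof.
elim: t a => // r t IHt a /and4P[r_n0 r_sorted r_below t_ss].
rewrite insert_cons; case: ltnP => [lt_r | ge_r] /=.
  by rewrite row_insert_neq0 sorted_row_insert // head_insert below_row_insert ?IHt.
apply/and4P; split=> //; last exact: below_rcons.
  by rewrite -(row_insert_rcons ge_r) row_insert_neq0.
by rewrite -(row_insert_rcons ge_r) sorted_row_insert.
Qed.

(** * Semistandardness of the recording tableau *)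

Lemma shape_add_box x j t : shape (add_box x j t) = incr_nth (shape t) j.
Proof.
rewrite /add_box; elim: t j => [|r t IHt] [|j] //=.
- by elim: j => //= j ->.
- by rewrite size_rcons.
- by rewrite IHt.
Qed.

Lemma shape_insert a t : shape (insert a t).1 = incr_nth (shape t) (insert a t).2.
Proof.
elim: t a => // r t IHt a; rewrite insert_cons; case: ltnP => [lt_r | _] /=.
  by rewrite IHt size_row_insert (maxn_idPr lt_r).
by rewrite size_rcons.
Qed.

Lemma size_head (t : tableau) : size (head [::] t) = head 0 (shape t).
Proof. by case: t. Qed.

(* The tableau [p] only certifies that the enlarged shape is a partition. *)
Lemma semistandard_add_box x j t p :
    semistandard p -> shape p = shape (add_box x j t) ->
    semistandard t -> all (all (fun y => y < x)) t ->
  semistandard (add_box x j t).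
Proof.
elim: t j p => [|r t IHt] [|j] [|q p] //=.
  (* A box at positive height over an empty [t] would leave an empty bottom row, which the nonempty
     rows of [p] exclude. *)
  by case: q => // b q _; rewrite /add_box /=; case: j.
- move=> _ _ /and4P[r_n0 r_sorted r_below t_ss] /andP[r_lt _].
  rewrite below_rcons // t_ss -size_eq0 size_rcons /= andbT.
  case: r r_n0 r_sorted r_lt {r_below} => //= b r _ r_path r_lt.
  rewrite rcons_path r_path /= ltnW //; exact: (allP (s := b :: r) r_lt) (mem_last b r).
- move=> /and4P[_ _ q_below p_ss] [szq shp].
  move=> /and4P[r_n0 r_sorted r_below t_ss] /andP[r_lt t_lt].
  rewrite -/(add_box x j t) in shp *.
  rewrite r_n0 r_sorted (IHt _ p) // andbT /=.
  (* This is where [p] enters: the row above [r] may have grown, and only the shape of [p] bounds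
     its new length. *)
  have le_head : size (head [::] (add_box x j t)) <= size r.
    rewrite size_head -shp -size_head -szq; case/belowP: q_below => le_q _.
    exact: le_q.
  apply/belowP; split=> // l lt_l.
  have [_ lt_r] := belowP _ _ r_below.
  have head_add : head [::] (add_box x j t) =
      if j is 0 then rcons (head [::] t) x else head [::] t.
    by rewrite /add_box; case: (t) (j) => [|? ?] [].
  have lt_lr := leq_trans lt_l le_head.
  move: lt_l; rewrite head_add; case: (j) => [|_].
    rewrite size_rcons nth_rcons ltnS => le_l; case: (ltnP l (size _)) => [|ge_l].
      exact: lt_r.
    by rewrite eqn_leq le_l ge_l; apply/(allP r_lt)/mem_nth.
  exact: lt_r.
Qed.

Lemma all_add_box (a : pred nat) x j t :
  a x -> all (all a) t -> all (all a) (add_box x j t).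
Proof.
move=> ax; rewrite /add_box; elim: t j => [|r t IHt] [|j] /=.
- by rewrite ax.
- by move=> _; elim: j => //=; rewrite ax.
- by rewrite all_rcons ax.
- by case/andP => -> t_a; apply: IHt.
Qed.

(** The bound [k] makes each new label larger than all earlier ones, and the insertion tableau, of
    the same shape, serves as the certificate required by [semistandard_add_box]. *)
Lemma foldl_RSK_step_semistandard s k p q :
    semistandard p -> semistandard q -> shape p = shape q ->
    all (all (fun y => y < k)) q ->
  let: (p', q') := foldl RSK_step (p, q) (zip s (iota k (size s))) in
  [/\ semistandard p', semistandard q' & shape p' = shape q'].
Proof.
elim: s k p q => //= a s IHs k p q p_ss q_ss shpq q_lt; rewrite /RSK_step /=.
have := semistandard_insert a p_ss; have := shape_insert a p.
case: insert => p1 j /= shp1 p1_ss; apply: IHs => //.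
- by apply: (semistandard_add_box p1_ss); rewrite ?shape_add_box ?shp1 ?shpq.
- by rewrite shape_add_box shp1 shpq.
- apply: all_add_box => //.
  by apply: sub_all q_lt => r; apply: sub_all => y /leqW.
Qed.

Lemma RSK_word_semistandard w :
  [/\ semistandard (RSK_word w).1, semistandard (RSK_word w).2
    & shape (RSK_word w).1 = shape (RSK_word w).2].
Proof.
have := @foldl_RSK_step_semistandard w 1 [::] [::] isT isT erefl isT.
by rewrite -/(RSK_word w); case: RSK_word.
Qed.

(** * Insertion of the reading word of a tableau *)

(* The tableau [r :: t] with its [l] first columns in place and the remaining
   columns of [t] still one row too low. *)
Fixpoint partial_rows l (r : seq nat) (t : tableau) : tableau :=
  if t is r' :: t' then (take l r ++ drop l r') :: partial_rows l r' t'
  else if l is 0 then [::] else [:: take l r].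

Lemma partial_rows0 r t : partial_rows 0 r t = t.
Proof. by elim: t r => //= r' t IHt r; rewrite take0 drop0 IHt. Qed.

Lemma partial_rows_oversize l r t :
  semistandard (r :: t) -> size r <= l -> partial_rows l r t = r :: t.
Proof.
elim: t r => [|r' t IHt] r /and4P[r_n0 _ /belowP[/= le_r _] t_ss] le_l.
  case: l le_l => [|l] le_l; last by rewrite /= take_oversize.
  by move: le_l; rewrite leqn0 size_eq0 (negbTE r_n0).
rewrite /= take_oversize // drop_oversize ?cats0 ?IHt //; exact: leq_trans le_l.
Qed.

(** A part of the conjugate partition. With rows indexed from 0, it is also the row of a box put on
    top of column [l]. *)
Definition column_height (sh : seq nat) l := count (fun m => l < m) sh.

Lemma column_height_oversize l r t :
  semistandard (r :: t) -> size r <= l -> column_height (shape (r :: t)) l = 0.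
Proof.
rewrite /column_height.
elim: t r => [|r' t IHt] r /and4P[_ _ /belowP[/= le_r _] t_ss] le_l.
  by rewrite /= ltnNge le_l.
rewrite [count _ _]/= ltnNge le_l add0n; exact: (IHt _ t_ss (leq_trans le_r le_l)).
Qed.

Lemma bump_pos_take_cat l r s : sorted leq r -> l < size r ->
  bump_pos (nth 0 r l) (take l r ++ s) = l + bump_pos (nth 0 r l) s.
Proof.
move=> r_sorted lt_l; rewrite /bump_pos find_cat size_take lt_l.
case: hasP => // -[b /(nthP 0)[i]].
rewrite size_take lt_l => lt_i <-; rewrite nth_take // ltnNge.
by rewrite nth_leq_sorted // ltnW.
Qed.

(** Induction up column [l]: the entries of [r] before that column are at most the inserted letter,
    while the entry of [r'] in it is strictly larger, so that entry is bumped and meets the next row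
    in the same situation. *)
Lemma insert_partial_rows l r t :
    semistandard (r :: t) -> l < size r ->
  insert (nth 0 r l) (partial_rows l r t) =
    (partial_rows l.+1 r t, column_height (shape t) l).
Proof.
elim: t r => [|r' t IHt] r /and4P[r_n0 r_sorted r_below t_ss] lt_l.
  case: l lt_l => [|l] lt_l.
    by case: r r_n0 {lt_l r_sorted r_below} => //= a r _; rewrite take0.
  have := bump_pos_take_cat [::] r_sorted lt_l.
  rewrite cats0 addn0 [partial_rows _ _ _]/= insert_cons => ->.
  by rewrite size_take lt_l ltnn -take_nth.
have [_ lt_r] := belowP _ _ r_below.
have size_tk : size (take l r) = l by rewrite size_take lt_l.
rewrite [partial_rows l _ _]/= insert_cons bump_pos_take_cat //.
rewrite size_cat size_tk ltn_add2l.
case: (ltnP l (size r')) => [lt_l'|ge_l'].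
  have bump0 : bump_pos (nth 0 r l) (drop l r') = 0.
    by rewrite (drop_nth 0 lt_l') /bump_pos /= lt_r.
  rewrite bump0 size_drop subn_gt0 lt_l' addn0.
  rewrite nth_cat size_tk ltnn subnn nth_drop addn0 IHt //= /row_insert.
  have set_nth_size a b s1 s2 : set_nth 0 (s1 ++ b :: s2) (size s1) a = s1 ++ a :: s2.
    by elim: s1 => //= c s1 ->.
  rewrite bump_pos_take_cat // bump0 addn0 (drop_nth 0 lt_l').
  rewrite -[X in set_nth 0 _ X]size_tk set_nth_size (take_nth 0 lt_l) cat_rcons.
  by rewrite /column_height /= lt_l'.
(* Column [l] misses [r'], hence all rows above it: the letter ends the bottom row and nothing is
   bumped. *)
rewrite column_height_oversize // partial_rows_oversize //.
rewrite [partial_rows _ _ _]/= partial_rows_oversize ?leqW //.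
by rewrite !drop_oversize ?leqW //= !cats0 -take_nth.
Qed.

(** The reading word starts with the upper rows, so their [sumn sh'] labels come first; each letter
    of the bottom row then adds a box on top of its own column. *)
Fixpoint recording_of_shape (sh : seq nat) : tableau :=
  if sh is m :: sh' then
    foldl (fun q l => add_box (sumn sh' + l).+1 (column_height sh' l) q)
      (recording_of_shape sh') (iota 0 m)
  else [::].

Lemma RSK_reading_word t :
  semistandard t -> RSK_word (reading_word t) = (t, recording_of_shape (shape t)).
Proof.
elim: t => // r t IHt rt_ss; have /and4P[_ _ _ t_ss] := rt_ss.
have sz_t : size (reading_word t) = sumn (shape t).
  by rewrite size_flatten /shape map_rev sumn_rev.
rewrite /RSK_word /reading_word rev_cons flatten_rcons -/(reading_word t).
rewrite size_cat iotaD zip_cat ?size_iota // foldl_cat -/(RSK_word _) (IHt t_ss).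
rewrite sz_t add1n /=; move: (recording_of_shape (shape t)) => q.
(* Generalized to the moment when [l] letters of [r] have been inserted and [m] remain, for
   induction on [m]. *)
suff H l m q' : l + m = size r ->
    foldl RSK_step (partial_rows l r t, q')
      (zip (drop l r) (iota (sumn (shape t) + l).+1 m)) =
    (partial_rows (size r) r t,
     foldl (fun q l => add_box (sumn (shape t) + l).+1 (column_height (shape t) l) q)
       q' (iota l m)).
  have := H 0 (size r) q erefl.
  by rewrite partial_rows0 partial_rows_oversize // drop0 addn0.
elim: m l q' => [|m IHm] l q'.
  by rewrite addn0 => ->; rewrite drop_size.
rewrite addnS -addSn => eq_lm.
have lt_l : l < size r by rewrite -eq_lm leq_addr.
rewrite (drop_nth 0 lt_l) /= /RSK_step /= insert_partial_rows // -IHm //.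
by rewrite addnS.
Qed.

Theorem theorem3p5 (n : nat) (hn : 1 <= n) (pi : 'S_n) :
  exists k : nat, k <= 2 /\ f (iter k (@f n) pi) = iter k (@f n) pi.
Proof.
have recording (sigma : 'S_n) :
    (RSK (f sigma)).2 = recording_of_shape (shape (RSK sigma).2)
    /\ shape (RSK (f sigma)).2 = shape (RSK sigma).2.
  have [_ ss _] := RSK_word_semistandard (word sigma).
  (* The shape is read off the insertion tableau of [f sigma], which is the recording tableau of
     [sigma] itself. *)
  have [_ _ <-] := RSK_word_semistandard (word (f sigma)).
  by rewrite /RSK word_f RSK_reading_word.
exists 2; split=> //=; apply: word_inj.
rewrite word_f [in RHS]word_f (proj1 (recording (f pi))).
by rewrite (proj2 (recording pi)) (proj1 (recording pi)).
Qed.
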